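(* For all parameter values $m\in\{0,1,2,\dots\}\cup\{\infty\}$ and integers $\ell\ge1$, and for all $\epsilon>0$, there exist an MDP $\langle X,A,P,r,\gamma\rangle$, an initial value function $v_0$, initial policies $\pi_0,\pi_{-1},\dots,\pi_{-\ell+2}$ and a sequence of error terms $(\epsilon_k)_{k\ge1}$ satisfying $\|\epsilon_k\|_\infty\le\epsilon$, such that MPI with parameters $m$ and $\ell$ run with these data can generate (for a suitable choice of greedy policies at each iteration) a sequence for which, for all iterations $k\ge1$, $$\|v_*-v_{\pi_{k,\ell}}\|_\infty= \frac{2(\gamma-\gamma^k)}{(1-\gamma)(1-\gamma^\ell)}\,\epsilon+\frac{2\gamma^k}{1-\gamma}\,\|v_*-v_0\|_\infty .$$
   Context: An MDP is a tuple $\langle X,A,P,r,\gamma\rangle$: $X$ is a (measurable) state space, $A$ a finite action set, $P(dy|x,a)$ a probability kernel, $r:X\times A\times X\to\mathbb R$ a bounded measurable reward, $0<\gamma<1$ a discount factor. A (stationary deterministic) policy is a measurable map $\pi:X\to A$. All value functions are bounded measurable functions $X\to\mathbb R$; in particular $v_0$ is. For a policy $\pi$: $P_\pi(dy|x)=P(dy|x,\pi(x))$, $(P_\pi f)(x)=\int f(y)P_\pi(dy|x)$, $r_\pi(x)=\int r(x,\pi(x),y)P_\pi(dy|x)$, and $T_\pi v=r_\pi+\gamma P_\pi v$. The value $v_\pi$ of $\pi$ is the unique fixed point of $T_\pi$ (the expected discounted sum of rewards under $\pi$). The optimal value is $v_*(x)=\max_\pi v_\pi(x)$. A policy $\pi$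 is greedy with respect to $v$ if $T_\pi v=\max_{\pi'}T_{\pi'}v$ (pointwise max); there may be several greedy policies. MPI with parameters $m$ and $\ell$: given $v_0$ and policies $\pi_0,\pi_{-1},\dots,\pi_{-\ell+2}$ (that is, $\ell-1$ policies), for $k=0,1,2,\dots$ let $\pi_{k+1}$ be a policy greedy with respect to $v_k$ and $$v_{k+1}=(T_{\pi_{k+1,\ell}})^m\,T_{\pi_{k+1}}v_k+\epsilon_{k+1},$$ where $\epsilon_{k+1}:X\to\mathbb R$ is an error term. For $k\ge1$, $\pi_{k,\ell}$ is the periodic non-stationary policy whose successive actions are selected by $\pi_k,\pi_{k-1},\dots,\pi_{k-\ell+1}$, then again $\pi_k,\pi_{k-1},\dots$, and so on; its operator is $T_{\pi_{k,\ell}}=T_{\pi_k}T_{\pi_{k-1}}\cdots T_{\pi_{k-\ell+1}}$, whose unique fixed point is the value $v_{\pi_{k,\ell}}$ of $\pi_{k,\ell}$. For $m=\infty$, $(T_{\pi_{k,\ell}})^\infty f:=v_{\pi_{k,\ell}}$ for every $f$. $\|\cdot\|_\infty$ is the sup norm. *)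

(* Defs.v *)
From HB Require Import structures.
From mathcomp Require Import all_boot all_order all_algebra.
From mathcomp Require Import all_classical all_reals all_analysis.

Set Implicit Arguments.
Unset Strict Implicit.
Unset Printing Implicit Defensive.
Import Order.TTheory GRing.Theory Num.Theory.
Import numFieldNormedType.Exports.
Local Open Scope classical_set_scope.
Local Open Scope ring_scope.

(* The finite action set carries the discrete sigma-algebra, so measurability
   jointly in state and action is measurability for each fixed action.  State
   spaces are nonempty: a measurableType is pointed. *)
Record mdp (R : realType) := Mdp {
  mdp_display : measure_display;
  state : measurableType mdp_display;
  action : finType;
  trans : action -> R.-pker state ~> state;
  reward : state -> action -> state -> R;
  reward_measurable : forall a : action,
    measurable_fun [set: state * state]
      (fun z : state * state => reward z.1 a z.2);
  reward_bounded :
    bounded_fun (fun z : state * action * state => reward z.1.1 z.1.2 z.2);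
  discount : R;
  discount_gt0 : 0 < discount;
  discount_lt1 : discount < 1
}.

Record policy (R : realType) (M : mdp R) := Policy {
  act :> state M -> action M;
  act_measurable : forall B : set (action M), measurable (act @^-1` B)
}.

(* The bounded measurable functions, among which value functions live. *)
Definition value_fun (R : realType) (M : mdp R) (v : state M -> R) : Prop :=
  measurable_fun [set: state M] v /\ bounded_fun v.

(* Valued in \bar R, so that the norm of an unbounded function is +oo. *)
Definition supnorm (R : realType) (T : Type) (f : T -> R) : \bar R :=
  ereal_sup (range (fun x : T => (`|f x|)%:E)).

Definition is_max (R : realType) (S : set R) (y : R) : Prop :=
  S y /\ ubound S y.

Section Operators.
Context (R : realType) (M : mdp R).
Implicit Types (p : policy M) (v : state M -> R).

Definition policy_trans p v : state M -> R :=
  fun x => \int[trans (p x) x]_y v y.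

Definition policy_reward p : state M -> R :=
  fun x => \int[trans (p x) x]_y reward x (p x) y.

Definition bellman p v : state M -> R :=
  fun x => policy_reward p x + discount M * policy_trans p v x.

(* The bounded measurable fixed point of T.  For a composition of one or more
   operators [bellman p] it exists and is unique by contraction; [get] is
   classical choice. *)
Definition value (T : (state M -> R) -> (state M -> R)) : state M -> R :=
  get [set v | value_fun v /\ T v = v].

Definition is_optimal_value (vstar : state M -> R) : Prop :=
  forall x, is_max [set value (bellman p) x | p in [set: policy M]] (vstar x).

Definition greedy v p : Prop :=
  forall x, is_max [set bellman q v x | q in [set: policy M]] (bellman p v x).

(* bellman (pi k) \o bellman (pi (k - 1)) \o ... \o bellman (pi (k - l + 1)) *)
Definition periodic_bellman (pi : int -> policy M) (l : nat) (k : int) v :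
    state M -> R :=
  foldr (fun (i : nat) (f : state M -> R) => bellman (pi (k - i%:Z)) f) v
    (iota 0 l).

(* [None] stands for the exponent infinity. *)
Definition operator_power (m : option nat)
    (T : (state M -> R) -> (state M -> R)) v : state M -> R :=
  match m with
  | Some n => iter n T v
  | None => value T
  end.

(* [pi] and [v] form a possible run from the initial value function [v0], the
   initial policies [pi0 i] = pi_{-i} for 0 <= i <= l - 2, and the error terms
   [err k] for k >= 1.  The values [err 0] and [pi j] for j < - l + 2
   are never used (nor is [pi 0] when l = 1). *)
Definition mpi_run (m : option nat) (l : nat) (v0 : state M -> R)
    (pi0 : 'I_l.-1 -> policy M) (err : nat -> state M -> R)
    (pi : int -> policy M) (v : nat -> state M -> R) : Prop :=
  [/\ v 0%N = v0,
      forall i : 'I_l.-1, pi (- (nat_of_ord i)%:Z) = pi0 i,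
      forall k : nat, value_fun (v k),
      forall k : nat, greedy (v k) (pi k.+1%:Z) &
      forall k : nat, v k.+1 =
        operator_power m (periodic_bellman pi l k.+1%:Z)
          (bellman (pi k.+1%:Z) (v k)) \+ err k.+1].

End Operators.

(* Main.v *)
Require Import Defs.
From mathcomp Require Import all_boot all_order all_algebra.
From mathcomp Require Import all_classical all_reals all_analysis.
From mathcomp Require Import zify ring lra.
Import Order.TTheory GRing.Theory Num.Theory.
Import numFieldNormedType.Exports.
Local Open Scope classical_set_scope.
Local Open Scope ring_scope.

(** The witness is a deterministic ladder.  The states are the natural
numbers.  From s one can go down to s - 1 for free, or, when s = i + 1, go up
to i + l and pay g * b_i, where g is the discount and
b_i = 2 eps (1 - g^i) / (1 - g); state 0 is a free trap.  Since rewards are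
never positive and going down is free, the optimal value is 0, which is also
taken as v_0: only the error term of the bound survives.

The run uses the policies pi_n that climb in state n and go down elsewhere.
Under the periodic policy of pi_k, ..., pi_{k-l+1}, the agent in state k climbs
to k + l - 1 and then walks down the l - 1 steps back to k, because at step j
the policy pi_{k-j} climbs l rungs below the agent; it pays g * b_{k-1} every l
steps for ever.  Hence the loss at k is
g * b_{k-1} / (1 - g^l) = 2 (g - g^k) eps / ((1 - g) (1 - g^l)),
and no other state loses more ([supnorm_loss]).

It remains to find errors that make pi_{k+1} greedy for v_k, that is
v_k (j + l) - v_k j <= b_j for all j, with equality (a tie between the two
actions) at j = k.  The errors are - eps at k, + eps at k + l and 0 elsewhere.
By the recurrence b_{k+1} = g b_k + 2 eps, this jump of 2 eps is exactly what
is missing after the noiseless part of the iteration, which turns the bounds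
b_j on the slopes of v_k into g * b_j, one rung higher, whatever m is
([update_sloped], [teeth_sloped]).  All the v_k vanish outside the states
k, k + l, k + 2l, ..., so they are described by the sequence of their values
there, on which one period of pi_{k+1}, pi_k, ... acts by a discounted shift
([comb_push]).

The argument works for every discount factor; the theorem takes 1/2. *)

(** * Sup norms and fixed points of contractions *)

Lemma bounded_funP (R : realType) (T : Type) (f : T -> R) :
  bounded_fun f <-> exists C, forall x, `|f x| <= C.
Proof.
split=> [[C [_ fC]]|[C fC]].
  by exists (C + 1) => x; apply: fC => //; rewrite ltrDl.
by exists C; split=> [|D CD x _]; [exact: num_real|exact: le_trans (fC x) (ltW CD)].
Qed.

Lemma supnorm_attained {R : realType} {T : Type} {f : T -> R} {C : R} {x : T} :
  `|f x| = C -> (forall y, `|f y| <= C) -> supnorm f = C%:E.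
Proof.
move=> fx fC; apply/eqP; rewrite eq_le; apply/andP; split.
  by apply: ge_ereal_sup => _ [y _ <-]; rewrite lee_fin.
by apply: ereal_sup_ubound; exists x => //; rewrite fx.
Qed.

(** The one-sided form of the uniqueness half of Banach's theorem: an upper
bound that can be improved by the factor g can be improved to g^n times it for
all n.  It serves both to identify fixed points and to bound them from above. *)
Lemma le0_of_self_contraction (R : realType) (T : Type) (g : R) (f : T -> R) :
    0 <= g -> g < 1 -> (exists C, forall x, f x <= C) ->
    (forall C, 0 <= C -> (forall x, f x <= C) -> forall x, f x <= g * C) ->
  forall x, f x <= 0.
Proof.
move=> g0 g1 [C fC] shrink x.
have fn n : forall y, f y <= g ^+ n * `|C|.
  elim: n => [y|n IH y]; first by rewrite mul1r (le_trans (fC y)) ?ler_norm.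
  by rewrite exprS -mulrA; apply: shrink => //; rewrite mulr_ge0 ?exprn_ge0.
have cv : (fun n => g ^+ n * `|C|) @ \oo --> (0 : R).
  rewrite -[X in _ --> X](mul0r `|C|); apply: cvgMl.
  by apply: cvg_expr; rewrite ger0_norm.
rewrite -(cvg_lim (@Rhausdorff R) cv); apply: limr_ge; first exact: cvgP cv.
by near=> n; exact: fn.
Unshelve. all: by end_near.
Qed.

Lemma value_eq (R : realType) (M : mdp R) T (g : R) (v : state M -> R) :
    0 <= g -> g < 1 ->
    (forall (u w : state M -> R) C, (forall x, `|u x - w x| <= C) ->
       forall x, `|T u x - T w x| <= g * C) ->
    value_fun v -> T v = v ->
  value T = v.
Proof.
move=> g0 g1 contr [mv bv] Tv; apply: get_unique => // w [[mw bw] Tw].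
apply/funext => x; apply/eqP; rewrite -subr_eq0 -normr_le0.
move: x; apply: (@le0_of_self_contraction _ _ g) => //; last first.
  by move=> C _ dC x; rewrite -Tv -Tw; exact: contr.
have [/bounded_funP[C vC] /bounded_funP[D wD]] := (bv, bw).
exists (D + C) => x; rewrite (le_trans (ler_normB _ _))//.
exact: lerD (wD x) (vC x).
Qed.

(** * The ladder *)

Section Ladder.
Variables (R : realType) (g eps : R) (l : nat).
Hypotheses (g_gt0 : 0 < g) (g_lt1 : g < 1) (l_gt0 : (0 < l)%N).
Hypothesis eps_gt0 : 0 < eps.

(** The slope b_k of the overview: the jump of v_k between k and k + l that
makes climbing from k + 1 exactly as good as going down. *)
Definition gap (k : nat) : R := 2 * eps * (1 - g ^+ k) / (1 - g).

Let onem_g : 0 < 1 - g. Proof. by rewrite subr_gt0. Qed.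

Lemma gap0 : gap 0 = 0. Proof. by rewrite /gap expr0 subrr mulr0 mul0r. Qed.

Lemma gapS k : gap k.+1 = g * gap k + 2 * eps.
Proof. by rewrite /gap exprS; field; rewrite gt_eqF. Qed.

Lemma gap_ge0 k : 0 <= gap k.
Proof.
by rewrite /gap !mulr_ge0 ?invr_ge0 ?(ltW onem_g) ?(ltW eps_gt0)// subr_ge0
  exprn_ile1// ltW.
Qed.

Lemma gap_le k : gap k <= 2 * eps / (1 - g).
Proof.
rewrite /gap ler_pM2r ?invr_gt0// ger_pMr ?mulr_gt0//.
by rewrite gerBl exprn_ge0// ltW.
Qed.

Lemma gap_homo : {homo gap : i j / (i <= j)%N >-> i <= j}.
Proof.
move=> i j ij; rewrite /gap ler_pM2r ?invr_gt0// ler_pM2l ?mulr_gt0//.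
by rewrite lerD2l lerN2 ler_wiXn2l// ltW.
Qed.

Lemma gapM_leS k : g * gap k <= gap k.+1.
Proof. by rewrite gapS lerDl mulr_ge0 ?ltW. Qed.

(** The action [true] climbs.  A period of l steps that starts with a climb
and continues downwards is a loop, hence the landing point i + l of i + 1. *)
Definition next_state (a : bool) (s : nat) : nat :=
  if a then if s is i.+1 then (i + l)%N else 0%N else s.-1.

Definition pay (a : bool) (s : nat) : R :=
  if a then if s is i.+1 then - (g * gap i) else 0 else 0.

Lemma pay_le0 a s : pay a s <= 0.
Proof.
case: a s => [] [|i] //=.
by rewrite oppr_le0 mulr_ge0 ?gap_ge0// ltW.
Qed.

Lemma pay_bounded :
  bounded_fun (fun z : nat * bool * nat => pay z.1.2 z.1.1).
Proof.
apply/bounded_funP; exists (2 * eps / (1 - g)) => -[[s a] s'] /=.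
rewrite ler0_norm ?pay_le0//; case: a s => [] [|i] /=;
  rewrite ?oppr0 ?divr_ge0 ?mulr_ge0 ?(ltW onem_g) ?(ltW eps_gt0)//.
by rewrite opprK (le_trans _ (gap_le i))// ler_piMl ?gap_ge0// ltW.
Qed.

Lemma measurable_fun_nat d (T : measurableType d) (f : nat -> T) :
  measurable_fun [set: nat] f.
Proof. by []. Qed.

Lemma measurable_pay (a : bool) :
  measurable_fun [set: nat * nat] (fun z : nat * nat => pay a z.1).
Proof.
exact: (measurableT_comp (measurable_fun_nat _ _ (pay a)) measurable_fst).
Qed.

Definition ladder : mdp R :=
  @Mdp R _ nat bool (fun a => kdirac (measurable_fun_nat _ _ (next_state a)))
    (fun s a _ => pay a s) measurable_pay pay_bounded g g_gt0 g_lt1.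

Lemma bellmanE (p : policy ladder) (v : nat -> R) s :
  bellman p v s = pay (p s) s + g * v (next_state (p s) s).
Proof.
rewrite /bellman /policy_reward /policy_trans /Rintegral /=.
by rewrite !integral_dirac// !diracT !mul1e.
Qed.

Definition rule (f : nat -> bool) : policy ladder :=
  @Policy R ladder f (fun _ => I).

Definition climb_at (n : int) : policy ladder := rule (fun s => s%:Z == n).

Lemma bellman_contract (p : policy ladder) (u w : nat -> R) C :
    (forall s, `|u s - w s| <= C) ->
  forall s, `|bellman p u s - bellman p w s| <= g * C.
Proof.
move=> uw s; rewrite !bellmanE opprD addrACA subrr add0r -mulrBr normrM.
by rewrite gtr0_norm// ler_pM2l.
Qed.

Lemma value_le0 (p : policy ladder) s : value (bellman p) s <= 0.
Proof.
rewrite /value; case: xgetP => [v _ [[_ /bounded_funP[C vC]] Tv]|_].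
  (* Rewards are nonpositive, so an upper bound on v improves to g times it. *)
  move: s; apply: (@le0_of_self_contraction _ _ g); rewrite ?(ltW g_gt0)//.
    by exists C => s; rewrite (le_trans (ler_norm _)).
  move=> D D0 vD s; rewrite -Tv bellmanE -[leRHS]add0r lerD ?pay_le0//.
  by rewrite ler_pM2l.
(* Without a bounded fixed point, the choice would return the default function,
   which is 0. *)
by [].
Qed.

Lemma ladder_optimal : is_optimal_value (M := ladder) (fun=> 0).
Proof.
move=> s; split; last by move=> _ [p _ <-]; exact: value_le0.
exists (rule (fun=> false)) => //.
rewrite (@value_eq _ _ _ g (fun=> 0)) ?(ltW g_gt0)//.
- exact: bellman_contract.
- by split; [exact: measurable_fun_nat|
    apply/bounded_funP; exists 0 => x; rewrite normr0].
- by apply/funext => x; rewrite bellmanE /= add0r mulr0.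
Qed.

(** Both the climbing rung n - j and the state lose one rung per step: a walker
who is not at the climbing rung now never meets it later.  State 0, where the walk can get stuck while the climbing rung goes on
down to 0 and below, is harmless because both actions agree there. *)
Lemma descent (n : int) (v : nat -> R) t j s :
    (s == 0%N) || (s%:Z != n - j%:Z) ->
  foldr (fun (i : nat) (f : nat -> R) => bellman (climb_at (n - i%:Z)) f) v
    (iota j t) s = g ^+ t * v (s - t)%N.
Proof.
elim: t j s => [|t IH] j s sn /=; first by rewrite mul1r subn0.
have -> : bellman (climb_at (n - j%:Z)) (foldr (fun (i : nat) (f : nat -> R) =>
    bellman (climb_at (n - i%:Z)) f) v (iota j.+1 t)) s =
  g * foldr (fun (i : nat) (f : nat -> R) => bellman (climb_at (n - i%:Z)) f)
     v (iota j.+1 t) s.-1.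
  rewrite bellmanE; case: s sn => [_|s /= /negbTE ->]; last by rewrite add0r.
  by case: (act _ _); rewrite /= add0r.
rewrite IH; last by lia.
by rewrite exprS mulrA; congr (_ * v _); lia.
Qed.

(** After the climb from k + 1 to k + l, the remaining l - 1 policies lead back
to k + 1; from any other state the whole period is a descent. *)
Lemma period_bellmanE k (v : nat -> R) s :
  periodic_bellman climb_at l k.+1%:Z v s =
  if s == k.+1 then - (g * gap k) + g ^+ l * v s else g ^+ l * v (s - l)%N.
Proof.
rewrite /periodic_bellman; case: eqP => [->|/eqP sk]; last first.
  by apply: descent; lia.
rewrite -{1 2}(prednK l_gt0) /= bellmanE /= subr0 eqxx /next_state /pay.
rewrite descent; last by lia.
by rewrite exprS mulrA; congr (_ + _ * v _); lia.
Qed.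

Lemma period_contract k (u w : nat -> R) C :
    (forall s, `|u s - w s| <= C) ->
  forall s, `|periodic_bellman climb_at l k.+1%:Z u s -
              periodic_bellman climb_at l k.+1%:Z w s| <= g ^+ l * C.
Proof.
move=> uw s; rewrite !period_bellmanE; have gl := exprn_gt0 l g_gt0.
case: ifP => _; first rewrite opprD addrACA subrr add0r;
  by rewrite -mulrBr normrM gtr0_norm// ler_pM2l.
Qed.

(** * Functions supported on k, k + l, k + 2l, ... *)

Definition comb k (f : nat -> R) (s : nat) : R :=
  if (k <= s)%N && (l %| s - k)%N then f ((s - k) %/ l)%N else 0.

Lemma comb_tooth k f p : comb k f (k + p * l) = f p.
Proof. by rewrite /comb leq_addr addKn dvdn_mull// mulnK. Qed.

Lemma comb_root k f : comb k f k = f 0%N.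
Proof. by rewrite -[X in comb _ _ X]addn0 -(mul0n l) comb_tooth. Qed.

Lemma comb_low k f s : (s < k + l)%N -> s != k -> comb k f s = 0.
Proof.
move=> skl sk; rewrite /comb; case: ifP => // /andP[ks].
by rewrite gtnNdvd; lia.
Qed.

Lemma comb_bounded k f :
  (exists C, forall p, `|f p| <= C) -> value_fun (M := ladder) (comb k f).
Proof.
move=> [C fC]; split; first exact: measurable_fun_nat.
have C0 : 0 <= C by rewrite (le_trans _ (fC 0%N)).
by apply/bounded_funP; exists C => s; rewrite /comb; case: ifP; rewrite ?normr0.
Qed.

(** The effect of one period of pi_{k+1}, pi_k, ... on the values at
k + 1 + p * l: the root pays and stays, the others move to the previous tooth. *)
Definition push k (f : nat -> R) (p : nat) : R :=
  if p is q.+1 then g ^+ l * f q else - (g * gap k) + g ^+ l * f 0%N.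

Lemma comb_push k f :
  periodic_bellman climb_at l k.+1%:Z (comb k.+1 f) = comb k.+1 (push k f).
Proof.
apply/funext => s; rewrite period_bellmanE.
case: eqP => [->|/eqP sk]; first by rewrite !comb_root.
have [skl|kls] := ltnP s (k.+1 + l).
  by rewrite !comb_low ?mulr0//; lia.
rewrite -(subnKC kls) /comb.
set t := (s - _)%N.
have -> : (k.+1 + l + t - l - k.+1 = t)%N by lia.
have -> : (k.+1 + l + t - k.+1 = l + t)%N by lia.
have -> : (k.+1 <= k.+1 + l + t - l)%N by lia.
have -> : (k.+1 <= k.+1 + l + t)%N by lia.
rewrite /= dvdn_addr// divnDl// divnn l_gt0 add1n /=.
by case: ifP; rewrite ?mulr0.
Qed.

(** The fixed point of that shift, i.e. the value of the periodic policy: from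
k + 1 + p * l one walks down for p periods, then loops at k + 1. *)
Definition push_fix k (p : nat) : R :=
  - (g * gap k) / (1 - g ^+ l) * (g ^+ l) ^+ p.

Let gl_lt1 : g ^+ l < 1.
Proof. by rewrite exprn_ilt1 ?(ltW g_gt0)// -lt0n. Qed.

Lemma push_push_fix k : push k (push_fix k) = push_fix k.
Proof.
apply/funext => -[|p]; rewrite /push /push_fix; last by rewrite exprS; ring.
by rewrite expr0; field; rewrite subr_eq0 eq_sym lt_eqF.
Qed.

Let gl_ge0 : 0 <= g ^+ l. Proof. exact: exprn_ge0 (ltW g_gt0). Qed.

Let ggap_ge0 k : 0 <= g * gap k.
Proof. exact: mulr_ge0 (ltW g_gt0) (gap_ge0 k). Qed.

Lemma loss_ge0 k : 0 <= g * gap k / (1 - g ^+ l).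
Proof. by apply: divr_ge0 => //; rewrite subr_ge0 ltW. Qed.

Lemma push_fix_le k p : `|push_fix k p| <= g * gap k / (1 - g ^+ l).
Proof.
have c0 := loss_ge0 k.
have gp0 : 0 <= (g ^+ l) ^+ p by rewrite exprn_ge0.
rewrite /push_fix !mulNr normrN ger0_norm; last exact: mulr_ge0.
by rewrite ler_piMr// exprn_ile1// ltW.
Qed.

Lemma value_climb k :
  value (periodic_bellman climb_at l k.+1%:Z) = comb k.+1 (push_fix k).
Proof.
apply: (@value_eq _ ladder _ (g ^+ l)) => //.
- exact: period_contract.
- by apply: comb_bounded; exists (g * gap k / (1 - g ^+ l)); exact: push_fix_le.
- by rewrite comb_push push_push_fix.
Qed.

Lemma supnorm_loss k :
  supnorm ((fun=> 0) \- value (periodic_bellman climb_at l k.+1%:Z)) =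
  (g * gap k / (1 - g ^+ l))%:E.
Proof.
rewrite value_climb; apply: (supnorm_attained (x := k.+1)) => [|s] /=.
  rewrite comb_root /push_fix sub0r normrN expr0 mulr1 mulNr normrN ger0_norm//.
  exact: loss_ge0.
rewrite sub0r normrN /comb.
by case: ifP => _; [exact: push_fix_le|rewrite normr0 loss_ge0].
Qed.

(** * The slope invariant *)

(** The greediness condition in terms of the values at the teeth.  The value
functions v_k satisfy it with c = 1, their images before the error is added
with c = g.  The sign of f 0 controls the jump from k - l, outside the support,
to k. *)
Definition sloped (c : R) k (f : nat -> R) : Prop :=
  [/\ f 0%N <= 0, f 1%N - f 0%N = c * gap k &
      forall p, f p.+1 - f p <= c * gap (k + p * l)].

Lemma comb_rise k f i :
  sloped 1 k f -> comb k f (i + l) - comb k f i <= gap i.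
Proof.
move=> [f0 _ fp]; have [ki|ik] := leqP k i; last first.
  (* Below the root the only jump is onto the root, where f is nonpositive. *)
  rewrite [X in _ - X]comb_low ?subr0; [|lia|lia].
  have [->|nk] := eqVneq (i + l)%N k.
    by rewrite comb_root (le_trans f0) ?gap_ge0.
  by rewrite comb_low ?gap_ge0//; lia.
rewrite -(subnKC ki); set t := (i - k)%N.
rewrite /comb -addnA !leq_addr !addKn.
rewrite dvdn_addl// divnDr// divnn l_gt0 addn1 /=.
case: ifP => [lt|_]; last by rewrite subr0 gap_ge0.
by rewrite (le_trans (fp _))// mul1r divnK.
Qed.

Lemma greedy_climb k f :
  sloped 1 k f -> greedy (M := ladder) (comb k f) (climb_at k.+1%:Z).
Proof.
move=> slf s; split; first by exists (climb_at k.+1%:Z).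
move=> _ [q _ <-]; rewrite !bellmanE.
case: s => [|i]; first by case: (act q _); case: (act _ _).
have -> : climb_at k.+1%:Z i.+1 = (i == k) by [].
have := comb_rise k f i slf; have [_ f1 _] := slf.
rewrite mul1r in f1.
have [->|_] := eqVneq i k; case: (act q _) => //=.
- have -> : comb k f (k + l) = f 1%N by rewrite -[in LHS](mul1n l) comb_tooth.
  by rewrite comb_root -f1; lra.
- by move=> rise; rewrite add0r addrC lerBlDl -mulrDr ler_pM2l// -lerBlDr.
Qed.

(** Thanks to the tie at k + 1, the greedy policy may be evaluated as if it went
down everywhere, so the Bellman step moves the comb up by one rung. *)
Lemma bellman_comb k f : sloped 1 k f -> comb k f 0%N = 0 ->
  bellman (climb_at k.+1%:Z) (comb k f) = comb k.+1 (fun p => g * f p).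
Proof.
move=> [_ f1 _] fk0; apply/funext => s; rewrite bellmanE.
case: s => [|i].
  by rewrite [RHS]comb_low//; case: (act _ _); rewrite /= fk0 mulr0 addr0.
have -> : climb_at k.+1%:Z i.+1 = (i == k) by [].
have [->|ik] := eqVneq i k; rewrite /=.
  have -> : comb k f (k + l) = f 1%N by rewrite -[in LHS](mul1n l) comb_tooth.
  by rewrite comb_root -[gap k]mul1r -f1; ring.
by rewrite add0r /comb ltnS subSS; case: ifP; rewrite ?mulr0.
Qed.

Definition update (m : option nat) k (f : nat -> R) : nat -> R :=
  if m is Some n then iter n (push k) (fun p => g * f p) else push_fix k.

Lemma operator_power_comb m k f :
  operator_power m (periodic_bellman climb_at l k.+1%:Z)
    (comb k.+1 (fun p => g * f p)) = comb k.+1 (update m k f).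
Proof.
case: m => [n|]; last exact: value_climb.
by elim: n => //= n ->; rewrite comb_push.
Qed.

(** The slope at the root is the same for all m.  Without a period it is the
discounted slope of f; with one or more, the root makes one payment more than
the next tooth, the first and undiscounted one, and the rest of the two values
coincides.  The later slopes are discounted earlier ones. *)
Lemma update_sloped m k f : sloped 1 k f -> sloped g k (update m k f).
Proof.
move=> [f0 f1 fp]; case: m => [n|] /=; last first.
  have rise p : push_fix k p.+1 - push_fix k p = g * gap k * (g ^+ l) ^+ p.
    by rewrite /push_fix exprS; field; rewrite subr_eq0 eq_sym lt_eqF.
  have glp p : (g ^+ l) ^+ p <= 1.
    by apply: exprn_ile1 => //; exact: ltW.
  split=> [||p].
  - by rewrite /push_fix expr0 mulr1 mulNr oppr_le0 loss_ge0.
  - by rewrite rise expr0 mulr1.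
  - rewrite rise (@le_trans _ _ (g * gap k))//.
      by rewrite ler_piMr.
    by rewrite ler_pM2l// gap_homo// leq_addr.
elim: n => [|n [h0 h1 hp]] /=.
  split=> [||p]; first by rewrite pmulr_rle0.
    by rewrite -mulrBr f1 mul1r.
  by rewrite -mulrBr ler_pM2l// -[leRHS]mul1r.
(* The case p = 0 is the equality at the root; the other slopes of the shifted
   sequence are g^l times the preceding ones, and the slopes b increase. *)
set h := iter n _ _ in h0 h1 hp *; split=> [||[|p]].
- rewrite /push -[leRHS]addr0 lerD ?mulr_ge0_le0//.
  by rewrite oppr_le0.
- by rewrite /push; ring.
- by rewrite /push mul0n addn0 opprD opprK addrCA subrr addr0.
- rewrite /push -mulrBr (@le_trans _ _ (g ^+ l * (g * gap (k + p * l))))//.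
    by rewrite ler_wpM2l.
  rewrite (@le_trans _ _ (g * gap (k + p * l)))//.
    by rewrite ler_piMl// ltW.
  by rewrite ler_pM2l// gap_homo// mulSn addnCA leq_addl.
Qed.

Lemma push_bounded k f : bounded_fun f -> bounded_fun (push k f).
Proof.
move=> /bounded_funP[C fC]; apply/bounded_funP.
have flC p : `|g ^+ l * f p| <= g ^+ l * C.
  by rewrite normrM ger0_norm// ler_wpM2l.
exists (g * gap k + g ^+ l * C) => -[|p] /=.
  by rewrite (le_trans (ler_normD _ _))// normrN ger0_norm// lerD2l.
by rewrite (le_trans (flC p))// lerDr.
Qed.

Lemma update_bounded m k f : bounded_fun f -> bounded_fun (update m k f).
Proof.
case: m => [n|] /= bf; last first.
  by apply/bounded_funP; exists (g * gap k / (1 - g ^+ l)); exact: push_fix_le.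
elim: n => [|n IH] /=; last exact: push_bounded.
move: bf => /bounded_funP[C fC].
apply/bounded_funP; exists (g * C) => p.
by rewrite normrM gtr0_norm// ler_pM2l.
Qed.

(** * The run *)

(** The error term, as values at the teeth. *)
Definition bump (p : nat) : R :=
  match p with 0%N => - eps | 1%N => eps | _ => 0 end.

Lemma bump_le p : `|bump p| <= eps.
Proof. by case: p => [|[|p]]; rewrite /= ?normrN ?normr0 ?gtr0_norm// ltW. Qed.

Lemma comb_bump_le k s : `|comb k bump s| <= eps.
Proof.
by rewrite /comb; case: ifP => _; rewrite ?bump_le// normr0 ltW.
Qed.

Lemma combD k f h : comb k (f \+ h) = comb k f \+ comb k h.
Proof. by apply/funext => s /=; rewrite /comb; case: ifP; rewrite ?addr0. Qed.

(** The values of v_k at k, k + l, k + 2l, ... *)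
Fixpoint teeth (m : option nat) (k : nat) : nat -> R :=
  if k is j.+1 then update m j (teeth m j) \+ bump else fun=> 0.

(** The errors raise the slope at the root from g * b_k to
g * b_k + 2 eps = b_{k+1}, lower the next one by eps and leave the others. *)
Lemma teeth_sloped m k : sloped 1 k (teeth m k).
Proof.
elim: k => [|k /(update_sloped m)] /=.
  by split=> [||p]; rewrite ?subrr ?gap0 ?mulr0 ?mul1r ?gap_ge0.
set F := update _ _ _ => -[F0 F1 Fp].
have slope p : F p.+1 - F p <= gap (k.+1 + p * l).
  by rewrite (le_trans (Fp p))// gapM_leS.
split=> [||[|[|p]]]; rewrite ?mul1r /=.
- by move: F0 eps_gt0; lra.
- by rewrite gapS -F1; ring.
- by rewrite mul0n addn0 gapS -F1; lra.
- by move: (slope 1%N) eps_gt0; lra.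
- by rewrite !addr0; exact: slope.
Qed.

Lemma teeth_bounded m k : bounded_fun (teeth m k).
Proof.
elim: k => [|k /(update_bounded m k)/bounded_funP[C FC]] /=.
  by apply/bounded_funP; exists 0 => p; rewrite normr0.
apply/bounded_funP; exists (C + eps) => p.
by rewrite (le_trans (ler_normD _ _))// lerD ?bump_le.
Qed.

Lemma comb_teeth_bottom m k : comb k (teeth m k) 0%N = 0.
Proof. by case: k => [|k]; [rewrite comb_root|rewrite comb_low]. Qed.

Lemma ladder_mpi_run m :
  mpi_run m (M := ladder) (fun=> 0)
    (fun i : 'I_l.-1 => climb_at (- (nat_of_ord i)%:Z))
    (fun k => comb k bump) climb_at (fun k => comb k (teeth m k)).
Proof.
split=> // [|k|k|k].
- by apply/funext => s; rewrite /comb; case: ifP.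
- exact/comb_bounded/bounded_funP/teeth_bounded.
- exact/greedy_climb/teeth_sloped.
- rewrite bellman_comb; [|exact: teeth_sloped|exact: comb_teeth_bottom].
  by rewrite operator_power_comb combD.
Qed.

End Ladder.

Theorem theorem3 (R : realType) (m : option nat) (l : nat) (eps : R)
    (hl : (1 <= l)%N) (heps : 0 < eps) :
  exists (M : mdp R) (v0 : state M -> R) (pi0 : 'I_l.-1 -> policy M)
         (err : nat -> state M -> R),
    (forall k : nat, (1 <= k)%N -> (supnorm (err k) <= eps%:E)%E) /\
    exists (pi : int -> policy M) (v : nat -> state M -> R)
           (vstar : state M -> R),
      [/\ mpi_run m v0 pi0 err pi v,
          is_optimal_value vstar &
          forall k : nat, (1 <= k)%N ->
            let g := discount M in
            supnorm (vstar \- value (periodic_bellman pi l k%:Z))%R =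
            ((2 * (g - g ^+ k) / ((1 - g) * (1 - g ^+ l)) * eps)%R%:E
             + (2 * g ^+ k / (1 - g))%R%:E * supnorm (vstar \- v0)%R)%E].
Proof.
have g0 : 0 < 2^-1 :> R by rewrite invr_gt0.
have g1 : 2^-1 < 1 :> R by rewrite invf_lt1// ltr1n.
exists (ladder _ _ _ l g0 g1 heps), (fun=> 0).
exists (fun i => climb_at _ _ _ _ _ _ _ (- (nat_of_ord i)%:Z)).
exists (fun k => comb R l k (bump R eps)); split.
  move=> k _; apply: ge_ereal_sup => _ [s _ <-]; rewrite lee_fin.
  exact: comb_bump_le.
exists (climb_at _ _ _ _ _ _ _), (fun k => comb R l k (teeth R 2^-1 eps l m k)).
exists (fun=> 0); split; [exact: ladder_mpi_run|exact: ladder_optimal|].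
move=> [//|k] _; rewrite [discount _]/=; move: (2^-1) g0 g1 => g g0 g1 /=.
rewrite supnorm_loss//.
have -> : supnorm ((fun=> 0) \- (fun=> 0) : nat -> R) = 0%E.
  by apply: (supnorm_attained (x := 0%N)) => [|s]; rewrite /= subrr normr0.
rewrite mule0 adde0 /gap exprS; congr (_%:E); field.
have gl : g ^+ l < 1 by rewrite exprn_ilt1 ?(ltW g0)// -lt0n.
by rewrite !subr_eq0 ![1 == _]eq_sym !lt_eqF.
Qed.
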